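(* Let $n\ge1$. In $\mathrm{NCSym}$ the following hold. (1) $x_{\llbracket n\rrbracket}=\sum_{\sigma\vdash[n]}(-1)^{\ell(\sigma)-1}(\ell(\sigma)-1)!\,p_\sigma.$ (2) $\omega(x_{\llbracket n\rrbracket})=(-1)^{n-1}\sum_{\sigma\vdash[n]}(\ell(\sigma)-1)!\,p_\sigma.$ (3) For every set partition $\pi\vdash[n]$, $\omega(x_\pi)$ is either $p$-positive or $p$-negative.
   Context: A set partition $\pi\vdash[n]$ of $[n]=\{1,\dots,n\}$ is a collection of disjoint nonempty subsets (blocks) with union $[n]$; $\ell(\pi)$ is its number of blocks; $\llbracket n\rrbracket$ is the set partition with the single block $[n]$. Set partitions of $[n]$ are ordered by refinement: $\sigma\le\pi$ if each block of $\sigma$ is contained in a block of $\pi$. $u$ is the Möbius function of this lattice: for $\sigma\le\pi$, $u(\sigma,\pi)=\prod_i(-1)^{k_i-1}(k_i-1)!$ where $k_i$ is the number of blocks of $\sigma$ contained in the $i$th block of $\pi$. $\mathrm{NCSym}\subset\mathbb{Q}[[\mathbf{x}_1,\mathbf{x}_2,\dots]]$ (noncommuting variables) is the algebra of symmetric functions in noncommuting variables; its degree-$n$ piece has $\mathbb{Q}$-basis $\{p_\pi\}_{\pi\vdash[n]}$, where $p_\pi=\sum\mathbf{x}_{i_1}\cdots\mathbf{x}_{i_n}$ over all tuples of positive integers with $i_j=i_k$ whenever $j,k$ are in the same block of $\pi$. The $x$-basis is $x_\pi=\sum_{\sigma\le\pi}u(\sigma,\pi)\,p_\sigma$. The involution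 $\omega$ of $\mathrm{NCSym}$ is the linear map with $\omega(p_\pi)=(-1)^{n-\ell(\pi)}p_\pi$ for $\pi\vdash[n]$. An element is $p$-positive (respectively $p$-negative) if all coefficients appearing (i.e. all nonzero coefficients) in its expansion in the $p$-basis are positive (respectively negative). *)

(* Defs.v *)
From HB Require Import structures.
From mathcomp Require Import all_boot all_order all_algebra.
From mathcomp Require Import boolp functions.

Set Implicit Arguments.
Unset Strict Implicit.
Unset Printing Implicit Defensive.

Import Order.TTheory GRing.Theory Num.Theory.
Local Open Scope ring_scope.

(* The ground set is 'I_n = {0, ..., n-1} instead of {1, ..., n}. *)
Record setpart (n : nat) := SetPart {
  blocks :> {set {set 'I_n}};
  blocksP : partition blocks [set: 'I_n] }.

HB.instance Definition _ n := [isSub for @blocks n].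
HB.instance Definition _ n := [Finite of setpart n by <:].

Definition ell n (pi : setpart n) : nat := #|blocks pi|.

Lemma one_block_subproof n : (0 < n)%N ->
  partition [set [set: 'I_n]] [set: 'I_n].
Proof.
move=> n0; apply/and3P; split.
- by rewrite /cover big_set1.
- by apply/trivIsetP => A B; rewrite !inE => /eqP-> /eqP->; rewrite eqxx.
- rewrite inE; apply/eqP => /setP/(_ (Ordinal n0)).
  by rewrite !inE.
Qed.

Definition one_block n (hn : (0 < n)%N) : setpart n :=
  SetPart (one_block_subproof hn).

Definition refines n (sigma pi : setpart n) : bool :=
  [forall A in blocks sigma, exists B in blocks pi, A \subset B].

Definition nsub n (sigma : setpart n) (B : {set 'I_n}) : nat :=
  #|[set A in blocks sigma | A \subset B]|.

(* Only meaningful when [refines sigma pi] holds; then [nsub sigma B] is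
   positive for every block B of pi and the predecessor is not truncated. *)
Definition mobius n (sigma pi : setpart n) : rat :=
  \prod_(B in blocks pi)
     ((-1) ^+ (nsub sigma B).-1 * ((nsub sigma B).-1)`!%:R).

(* A formal power series in countably many noncommuting variables is given by
   the coefficients of its monomials; the monomial x_{i_1} ... x_{i_m} is the
   word [:: i_1; ...; i_m].  The variables are indexed from 0. *)
Definition ncseries := (seq nat -> rat)%type.
HB.instance Definition _ := GRing.Lmodule.copy ncseries (seq nat -> rat^o).

Definition symmetric_series (f : ncseries) : Prop :=
  forall s : nat -> nat, bijective s -> forall w, f (map s w) = f w.

Definition bounded_degree (f : ncseries) : Prop :=
  exists d : nat, forall w, f w != 0 -> (size w < d)%N.

Definition ncsym : {pred ncseries} :=
  fun f => `[< symmetric_series f /\ bounded_degree f >].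

Lemma ncsymP (f : ncseries) :
  reflect (symmetric_series f /\ bounded_degree f) (f \in ncsym).
Proof. exact: asboolP. Qed.

Lemma ncsym_submod_closed : submod_closed ncsym.
Proof.
split.
  by apply/ncsymP; split=> //; exists 0%N => w; rewrite eqxx.
move=> a f g /ncsymP[sf [df hf]] /ncsymP[sg [dg hg]]; apply/ncsymP; split.
  move=> s bs w.
  by rewrite -[LHS]/(a * f (map s w) + g (map s w)) sf // sg.
exists (maxn df dg) => w; rewrite -[_ w]/(a * f w + g w) leq_max => nz.
have [f0|/hf->//] := eqVneq (f w) 0.
by rewrite (hg w) ?orbT //; move: nz; rewrite f0 mulr0 add0r.
Qed.

HB.instance Definition _ :=
  GRing.isSubmodClosed.Build rat ncseries ncsym ncsym_submod_closed.

Record NCSym := MkNCSym { series : ncseries; seriesP : series \in ncsym }.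

HB.instance Definition _ := [isSub for series].
HB.instance Definition _ := [Choice of NCSym by <:].
HB.instance Definition _ := [SubChoice_isSubLmodule of NCSym by <:].

(* Every word occurs at most once in the sum defining p_pi, so the
   coefficients of p_pi are 0 and 1. *)
Definition compatible n (pi : setpart n) (w : seq nat) : bool :=
  (size w == n) &&
  [forall B in blocks pi, forall j in B, forall k in B,
     nth 0%N w (j : 'I_n) == nth 0%N w (k : 'I_n)].

Definition p_series n (pi : setpart n) : ncseries :=
  fun w => (compatible pi w)%:R.

Lemma p_series_ncsym n (pi : setpart n) : p_series pi \in ncsym.
Proof.
apply/ncsymP; split; last first.
  exists n.+1 => w; rewrite /p_series /compatible ltnS.
  by have [->//|_] := eqVneq (size w) n; rewrite eqxx.
move=> s bs w; rewrite /p_series /compatible size_map.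
have [sw|//] := eqVneq (size w) n; congr (nat_of_bool _)%:R.
apply: eq_forallb => B; congr (_ ==> _); apply: eq_forallb => j.
congr (_ ==> _); apply: eq_forallb => k; congr (_ ==> _).
by rewrite !(nth_map 0%N) ?sw // (inj_eq (bij_inj bs)).
Qed.

Definition p n (pi : setpart n) : NCSym := MkNCSym (p_series_ncsym pi).

Definition x n (pi : setpart n) : NCSym :=
  \sum_(sigma : setpart n | refines sigma pi) mobius sigma pi *: p sigma.

Lemma sum_seriesE (I : Type) (r : seq I) (P : pred I) (F : I -> NCSym) w :
  series (\sum_(i <- r | P i) F i) w = \sum_(i <- r | P i) series (F i) w.
Proof. by apply: (big_morph (fun f : NCSym => series f w)). Qed.

Lemma NCSym_eq (f g : NCSym) : (forall w, series f w = series g w) -> f = g.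
Proof. by move=> fg; apply: val_inj; apply: funext. Qed.

Lemma bij_extend (a b : seq nat) : size a = size b -> uniq a -> uniq b ->
  exists2 s : nat -> nat, bijective s & map s a = b.
Proof.
elim: a b => [|i a IH] [|j b] //=; first by exists id => //; exists id.
case=> sab /andP[ia ua] /andP[jb ub].
have [s bs sE] := IH b sab ua ub.
pose t k := if k == s i then j else if k == j then s i else k.
have tK : involutive t.
  move=> k; rewrite /t; case: (eqVneq k (s i)) => [->|ki].
    by rewrite eqxx; case: eqP.
  case: (eqVneq k j) => [->|kj]; first by rewrite eqxx.
  by rewrite (negbTE ki) (negbTE kj).
exists (t \o s); first by apply: bij_comp bs; exists t.
rewrite /= {1}/t eqxx map_comp sE; congr (_ :: _).
rewrite -[RHS]map_id; apply/eq_in_map => k kb; rewrite /t.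
rewrite ifN; last first.
  apply/eqP => ki; move: kb; rewrite ki -sE (mem_map (bij_inj bs)).
  by rewrite (negbTE ia).
by rewrite ifN //; apply: contraNneq jb => <-.
Qed.

Lemma same_kernel_bij (v w : seq nat) : size v = size w ->
  (forall i j, (i < size v)%N -> (j < size v)%N ->
     (nth 0 v i == nth 0 v j)%N = (nth 0 w i == nth 0 w j)%N) ->
  exists2 s : nat -> nat, bijective s & map s v = w.
Proof.
move=> sz ker; pose g k := nth 0%N w (index k v).
have gE i : (i < size v)%N -> g (nth 0%N v i) = nth 0%N w i.
  move=> iv; rewrite /g; apply/eqP; rewrite -ker ?nth_index ?mem_nth //.
  by rewrite index_mem mem_nth.
have gi : {in v &, injective g}.
  move=> k l kv lv /eqP; rewrite /g -ker ?index_mem // !nth_index //.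
  by move/eqP.
have [s bs sE] : exists2 s : nat -> nat,
    bijective s & map s (undup v) = map g (undup v).
  apply: bij_extend; rewrite ?size_map ?undup_uniq //.
  rewrite map_inj_in_uniq ?undup_uniq // => k l; rewrite !mem_undup.
  exact: gi.
exists s => //; apply: (@eq_from_nth _ 0%N); rewrite size_map // => i iv.
rewrite (nth_map 0%N) // -gE //.
by move/eq_in_map: sE; apply; rewrite mem_undup mem_nth.
Qed.

Section Basis.
Variable n : nat.
Implicit Types sigma pi tau : setpart n.

Lemma pblockP pi i : i \in pblock pi i.
Proof.
have /and3P[/eqP cov _ _] := blocksP pi.
by rewrite mem_pblock cov inE.
Qed.

Lemma pblock_in pi i : pblock pi i \in blocks pi.
Proof.
have /and3P[/eqP cov _ _] := blocksP pi.
by rewrite pblock_mem // cov inE.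
Qed.

Lemma blockE pi B i : B \in blocks pi -> i \in B -> pblock pi i = B.
Proof. by have /and3P[_ tI _] := blocksP pi; exact: def_pblock. Qed.

Lemma blocksE pi B :
  (B \in blocks pi) = [exists i, B == pblock pi i].
Proof.
apply/idP/existsP => [Bpi|[i /eqP->]]; last exact: pblock_in.
have /and3P[_ _ n0] := blocksP pi.
have [B0|[i iB]] := set_0Vmem B; first by rewrite -B0 Bpi in n0.
by exists i; rewrite (blockE Bpi iB).
Qed.

Lemma refinesP sigma pi :
  reflect (forall i j, j \in pblock sigma i -> j \in pblock pi i)
          (refines sigma pi).
Proof.
apply: (iffP forall_inP) => [h i j ji|h A].
  have /exists_inP[B Bpi AB] := h _ (pblock_in sigma i).
  by rewrite (blockE Bpi (subsetP AB _ (pblockP sigma i))) (subsetP AB).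
rewrite blocksE => /existsP[i /eqP->]; apply/exists_inP.
by exists (pblock pi i); [exact: pblock_in | apply/subsetP => j /h].
Qed.

Lemma refines_refl : reflexive (@refines n).
Proof. by move=> pi; apply/refinesP. Qed.

Lemma refines_trans : transitive (@refines n).
Proof.
by move=> b a c /refinesP ab /refinesP bc; apply/refinesP => i j /ab /bc.
Qed.

Lemma refines_anti : antisymmetric (@refines n).
Proof.
move=> a b /andP[/refinesP ab /refinesP ba].
have e i : pblock a i = pblock b i.
  by apply/setP => j; apply/idP/idP => [/ab|/ba].
apply: val_inj; apply/setP => B /=; rewrite !blocksE.
by apply: eq_existsb => i; rewrite e.
Qed.

Definition kernel (w : seq nat) : setpart n :=
  SetPart (preim_partitionP (fun i : 'I_n => nth 0%N w i) [set: 'I_n]).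

Lemma mem_kernel w i j :
  (j \in pblock (kernel w) i) = (nth 0 w i == nth 0 w j)%N.
Proof.
rewrite /= /preim_partition pblock_equivalence_partition ?inE //.
by split=> // /eqP->.
Qed.

Lemma compatibleE pi w :
  compatible pi w = (size w == n) && refines pi (kernel w).
Proof.
rewrite /compatible; case: (size w == n) => //=.
apply/forall_inP/refinesP => [h i j ji|h B].
  rewrite mem_kernel; move/forall_inP: (h _ (pblock_in pi i)).
  by move/(_ _ (pblockP pi i))/forall_inP; apply.
rewrite blocksE => /existsP[i /eqP->]; apply/forall_inP => j /h.
rewrite mem_kernel => /eqP <-; apply/forall_inP => k /h.
by rewrite mem_kernel.
Qed.

Definition word pi : seq nat :=
  [seq (enum_rank (pblock pi i) : nat) | i <- enum 'I_n].

Lemma size_word pi : size (word pi) = n.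
Proof. by rewrite size_map size_enum_ord. Qed.

Lemma nth_word pi (i : 'I_n) : nth 0%N (word pi) i = enum_rank (pblock pi i).
Proof. by rewrite (nth_map i) ?size_enum_ord // nth_ord_enum. Qed.

Lemma kernel_word pi : kernel (word pi) = pi.
Proof.
have e i j : (j \in pblock (kernel (word pi)) i) = (j \in pblock pi i).
  rewrite mem_kernel !nth_word (inj_eq (@ord_inj _)).
  rewrite (inj_eq enum_rank_inj); have /and3P[/eqP cov tI _] := blocksP pi.
  by rewrite eq_pblock // cov inE.
by apply: refines_anti; apply/andP; split; apply/refinesP => i j; rewrite e.
Qed.

Lemma NCSym_kernel (f : NCSym) w : size w = n -> series f (word (kernel w)) = series f w.
Proof.
move=> sw; have /ncsymP[sf _] := seriesP f.
have [||s bs <-] := @same_kernel_bij w (word (kernel w)); last exact: sf.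
  by rewrite size_word.
move=> i j; rewrite sw => ltin ltjn.
rewrite (nth_word _ (Ordinal ltin)) (nth_word _ (Ordinal ltjn)).
rewrite (inj_eq (@ord_inj _)) (inj_eq enum_rank_inj).
have /and3P[/eqP cov tI _] := blocksP (kernel w).
by rewrite eq_pblock // ?cov ?inE // mem_kernel.
Qed.

Lemma p_sum_eval (c : setpart n -> rat) w : size w = n ->
  series (\sum_pi c pi *: p pi) w =
  \sum_(pi | refines pi (kernel w)) c pi.
Proof.
move=> sw; rewrite sum_seriesE [RHS]big_mkcond; apply: eq_bigr => pi _.
rewrite -[LHS]/(c pi * p_series pi w) /p_series compatibleE sw eqxx /=.
by case: ifP; rewrite (mulr1, mulr0).
Qed.

Definition down pi := #|[set sigma | refines sigma pi]|.

Lemma down_lt sigma pi :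
  refines sigma pi -> sigma != pi -> (down sigma < down pi)%N.
Proof.
move=> sp ne; apply: proper_card; apply/properP; split.
  by apply/subsetP => a; rewrite !inE => /refines_trans; apply.
exists pi; rewrite !inE ?refines_refl //.
by apply: contra ne => ps; apply/eqP/refines_anti; rewrite sp.
Qed.

Lemma refinement_sum_ex (F : setpart n -> rat) :
  exists c : {ffun setpart n -> rat},
    forall tau, \sum_(pi | refines pi tau) c pi = F tau.
Proof.
have [c h] : exists c : {ffun setpart n -> rat}, forall tau,
    (down tau < #|{: setpart n}|.+1)%N ->
    \sum_(pi | refines pi tau) c pi = F tau.
  elim: _.+1 => [|k [c IH]]; first by exists [ffun => 0].
  exists [ffun tau => if (down tau < k)%N then c tau else
    F tau - \sum_(pi | refines pi tau && (pi != tau)) c pi] => tau.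
  rewrite ltnS => tk; rewrite (bigD1 tau) ?refines_refl //= ffunE.
  rewrite [X in _ + X](eq_bigr c) => [|pi /andP[pt ne]]; last first.
    by rewrite ffunE (leq_trans (down_lt pt ne) tk).
  case: ifP => [/IH <-|_]; last by rewrite subrK.
  by rewrite [RHS](bigD1 tau) ?refines_refl.
by exists c => tau; apply: h; rewrite ltnS max_card.
Qed.

Lemma refinement_sum_inj (c d : setpart n -> rat) :
  (forall tau, \sum_(pi | refines pi tau) c pi =
               \sum_(pi | refines pi tau) d pi) -> c =1 d.
Proof.
move=> cd tau; have [k] := ubnP (down tau).
elim: k tau => // k IH tau; rewrite ltnS => tk.
have := cd tau; rewrite (bigD1 tau) ?refines_refl //=.
rewrite [in RHS](bigD1 tau) ?refines_refl //=.
rewrite [X in _ + X = _](eq_bigr d) => [/addIr//|pi /andP[pt ne]].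
by apply: IH; apply: leq_trans tk; exact: down_lt.
Qed.

Definition hom_series (f : NCSym) : ncseries :=
  fun w => if size w == n then series f w else 0.

Lemma hom_ncsym (f : NCSym) : hom_series f \in ncsym.
Proof.
have /ncsymP[sf [d df]] := seriesP f.
apply/ncsymP; split=> [s bs w|].
  by rewrite /hom_series size_map sf.
by exists d => w; rewrite /hom_series; case: ifP => [_ /df//|]; rewrite eqxx.
Qed.

Definition hom_component (f : NCSym) : NCSym := MkNCSym (hom_ncsym f).

Lemma p_sum_eval0 (c : setpart n -> rat) w : size w != n ->
  series (\sum_pi c pi *: p pi) w = 0.
Proof.
move=> /negbTE sw; rewrite sum_seriesE big1 // => pi _.
rewrite -[LHS]/(c pi * p_series pi w) /p_series compatibleE sw.
by rewrite mulr0.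
Qed.

Lemma p_free (c d : setpart n -> rat) :
  \sum_pi c pi *: p pi = \sum_pi d pi *: p pi -> c =1 d.
Proof.
move=> cd; apply: refinement_sum_inj => tau.
by rewrite -(kernel_word tau) -!p_sum_eval ?size_word ?cd.
Qed.

Lemma p_span (f : NCSym) :
  exists c : {ffun setpart n -> rat}, hom_component f = \sum_pi c pi *: p pi.
Proof.
have [c cE] := refinement_sum_ex (fun tau => series f (word tau)).
exists c; apply: NCSym_eq => w; rewrite [LHS]/= /hom_series.
have [sw|sw] := eqVneq (size w) n; last by rewrite p_sum_eval0.
by rewrite p_sum_eval // cE NCSym_kernel.
Qed.

(* The coordinates are unique by p_free, so the choice made by cid is
   immaterial. *)
Definition pcoef (pi : setpart n) (f : NCSym) : rat :=
  projT1 (cid (p_span f)) pi.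

Lemma hom_pcoef (f : NCSym) : hom_component f = \sum_pi pcoef pi f *: p pi.
Proof. exact: projT2 (cid (p_span f)). Qed.

Lemma hom_is_linear : linear hom_component.
Proof.
move=> a f g; apply: NCSym_eq => w.
rewrite -[RHS]/(a * hom_series f w + hom_series g w) [LHS]/= /hom_series.
by case: ifP => // _; rewrite mulr0 addr0.
Qed.

HB.instance Definition _ :=
  GRing.isLinear.Build rat NCSym NCSym *:%R hom_component hom_is_linear.

Lemma pcoef_is_linear pi : linear_for *%R (pcoef pi).
Proof.
move=> a f g; move: pi.
apply: (@p_free _ (fun pi => a * pcoef pi f + pcoef pi g)).
rewrite -hom_pcoef hom_is_linear !hom_pcoef scaler_sumr -big_split.
by apply: eq_bigr => pi _; rewrite scalerDl scalerA.
Qed.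

HB.instance Definition _ pi :=
  GRing.isLinear.Build rat NCSym rat *%R (pcoef pi) (pcoef_is_linear pi).

End Basis.

Definition degree_bound (f : NCSym) : nat :=
  projT1 (cid (proj2 (ncsymP (series f) (seriesP f)))).

Lemma p_expansion_ge (f : NCSym) d : (degree_bound f <= d)%N ->
  f = \sum_(n < d) \sum_(pi : setpart n) pcoef pi f *: p pi.
Proof.
rewrite /degree_bound; case: cid => e /= fe ed.
rewrite (eq_bigr (fun n : 'I_d => hom_component n f)) => [|n _]; last by rewrite hom_pcoef.
apply: NCSym_eq => w; rewrite sum_seriesE.
have [wd|dw] := ltnP (size w) d.
  rewrite (bigD1 (Ordinal wd)) //= /hom_series eqxx big1 ?addr0 // => i.
  by rewrite -val_eqE /= eq_sym => /negbTE->.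
rewrite big1 => [|i _]; last first.
  by rewrite /= /hom_series gtn_eqF // (leq_trans (ltn_ord i)).
apply/eqP; apply: contraTT dw => /fe we.
by rewrite -ltnNge (leq_trans we).
Qed.

Lemma p_expansion (f : NCSym) :
  f = \sum_(n < degree_bound f) \sum_(pi : setpart n) pcoef pi f *: p pi.
Proof. exact: p_expansion_ge. Qed.

Lemma hom_p n m (pi : setpart m) :
  hom_component n (p pi) = if n == m then p pi else 0.
Proof.
apply: NCSym_eq => w; rewrite [LHS]/= /hom_series [series _ _]/= /p_series compatibleE.
have [nm|nm] := eqVneq n m; rewrite [RHS]/= /p_series ?compatibleE.
  by rewrite nm; case: eqP.
by case: (size w =P n) => // ->; rewrite (negbTE nm).
Qed.

Lemma pcoef_p n (sigma pi : setpart n) : pcoef pi (p sigma) = (pi == sigma)%:R.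
Proof.
move: pi; apply: p_free; rewrite -hom_pcoef hom_p eqxx.
rewrite (bigD1 sigma) //= eqxx scale1r big1 ?addr0 // => pi /negbTE->.
by rewrite scale0r.
Qed.

Lemma pcoef_p_neq n m (sigma : setpart m) (pi : setpart n) :
  n != m -> pcoef pi (p sigma) = 0.
Proof.
move=> /negbTE nm; move: pi; apply: p_free.
rewrite -hom_pcoef hom_p nm big1 // => pi _.
by rewrite scale0r.
Qed.

Definition omega (f : NCSym) : NCSym :=
  \sum_(n < degree_bound f) \sum_(pi : setpart n)
     pcoef pi f *: ((-1) ^+ (n - ell pi) *: p pi).

Lemma pcoef_deg n (f : NCSym) (pi : setpart n) :
  (degree_bound f <= n)%N -> pcoef pi f = 0.
Proof.
rewrite /degree_bound; case: cid => e /= fe en.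
move: pi; apply: p_free; rewrite -hom_pcoef [RHS]big1 => [|pi _]; last first.
  by rewrite scale0r.
apply: NCSym_eq => w; rewrite /= /hom_series.
case: eqP => // wn; apply/eqP; apply: contraTT en => /fe.
by rewrite wn -ltnNge.
Qed.

Lemma omega_ge (f : NCSym) d : (degree_bound f <= d)%N ->
  omega f = \sum_(n < d) \sum_(pi : setpart n)
              pcoef pi f *: ((-1) ^+ (n - ell pi) *: p pi).
Proof.
move=> fd; rewrite /omega.
pose G n : NCSym := \sum_(pi : setpart n)
  pcoef pi f *: ((-1) ^+ (n - ell pi) *: p pi).
rewrite -(big_mkord xpredT G) -[RHS](big_mkord xpredT G).
rewrite [RHS](big_cat_nat (n := degree_bound f)) //=.
rewrite [X in _ + X]big_nat_cond [X in _ + X]big1 ?addr0 // => n.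
rewrite andbT => /andP[fn _]; apply: big1 => pi _.
by rewrite pcoef_deg // scale0r.
Qed.

Lemma omega_is_linear : linear omega.
Proof.
move=> a f g.
pose d := maxn (degree_bound (a *: f + g))
               (maxn (degree_bound f) (degree_bound g)).
rewrite !(@omega_ge _ d) ?leq_max ?leqnn ?orbT //.
rewrite scaler_sumr -big_split; apply: eq_bigr => n _ /=.
rewrite scaler_sumr -big_split; apply: eq_bigr => pi _ /=.
by rewrite pcoef_is_linear scalerDl -scalerA.
Qed.

HB.instance Definition _ :=
  GRing.isLinear.Build rat NCSym NCSym *:%R omega omega_is_linear.

Lemma omega_p n (pi : setpart n) :
  omega (p pi) = (-1) ^+ (n - ell pi) *: p pi.
Proof.
pose d := maxn (degree_bound (p pi)) n.+1.
rewrite (@omega_ge _ d) ?leq_maxl //.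
have nd : (n < d)%N by rewrite leq_maxr.
rewrite (bigD1 (Ordinal nd)) //= (bigD1 pi) //= pcoef_p eqxx scale1r.
rewrite !big1 ?addr0 // => [m|sigma /negbTE ne]; last first.
  by rewrite pcoef_p ne scale0r.
rewrite -val_eqE /= => mn; apply: big1 => sigma _.
by rewrite pcoef_p_neq // scale0r.
Qed.

Definition p_positive (f : NCSym) : Prop :=
  forall n (pi : setpart n), pcoef pi f != 0 -> 0 < pcoef pi f.

Definition p_negative (f : NCSym) : Prop :=
  forall n (pi : setpart n), pcoef pi f != 0 -> pcoef pi f < 0.

(* Main.v *)
Require Import Defs.
From mathcomp Require Import all_boot all_order all_algebra.
Import GRing.Theory Num.Theory.
Local Open Scope ring_scope.

(** A refinement [sigma] of [pi] has [ell sigma = \sum_B nsub sigma B], summed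
over the blocks [B] of [pi], so [mobius sigma pi] has sign
[(-1) ^+ (ell sigma - ell pi)].  Since [omega] multiplies [p sigma] by
[(-1) ^+ (n - ell sigma)], every coefficient of [omega (x pi)] gets the same
sign [(-1) ^+ (n - ell pi)]. *)

(** Blocks are nonempty, so each contributes at least one to [n]; hence [n - ell pi] is never
    truncated. *)
Lemma ell_le n (pi : setpart n) : (ell pi <= n)%N.
Proof.
rewrite -[leqRHS]card_ord -cardsT (card_partition (blocksP pi)) /ell -sum1_card.
apply: leq_sum => B; rewrite blocksE => /existsP[i /eqP->].
by rewrite card_gt0; apply/set0Pn; exists i; exact: pblockP.
Qed.

Section Refinement.
Variables (n : nat) (sigma pi : setpart n).
Hypothesis sp : refines sigma pi.

(** Blocks of [pi] are disjoint, so only the one through [i] can contain the [sigma]-block of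
    [i]. *)
Lemma block_above i B : B \in blocks pi ->
  (pblock sigma i \subset B) = (B == pblock pi i).
Proof.
move=> Bpi; apply/idP/eqP => [/subsetP/(_ i (pblockP sigma i)) iB|->].
  by rewrite (blockE Bpi iB).
by apply/subsetP => j; move/refinesP: sp; apply.
Qed.

Lemma nsub_gt0 B : B \in blocks pi -> (0 < nsub sigma B)%N.
Proof.
rewrite blocksE => /existsP[i /eqP->]; rewrite card_gt0; apply/set0Pn.
by exists (pblock sigma i); rewrite inE pblock_in block_above ?pblock_in /=.
Qed.

Lemma ell_sum_nsub : ell sigma = (\sum_(B in blocks pi) nsub sigma B)%N.
Proof.
rewrite /ell -sum1_card.
under [RHS]eq_bigr => B _ do rewrite /nsub -sum1dep_card big_mkcondr.
(* Double counting: each block [A] of [sigma] lies in exactly one block of [pi], so its inner sum is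
   1. *)
rewrite exchange_big /=; apply: eq_bigr => A.
rewrite blocksE => /existsP[i /eqP->].
rewrite (bigD1 (pblock pi i)) ?pblock_in //= block_above ?pblock_in // eqxx.
by rewrite big1 // => B /andP[Bpi /negbTE ne]; rewrite block_above ?ne.
Qed.

Lemma ell_sum_pred_nsub :
  ell sigma = (\sum_(B in blocks pi) (nsub sigma B).-1 + ell pi)%N.
Proof.
rewrite ell_sum_nsub [ell pi]/ell -sum1_card -big_split /=.
by apply: eq_bigr => B Bpi; rewrite addn1 prednK ?nsub_gt0.
Qed.

Lemma mobiusE : mobius sigma pi = (-1) ^+ (ell sigma - ell pi) *
  \prod_(B in blocks pi) ((nsub sigma B).-1)`!%:R.
Proof. by rewrite /mobius big_split /= prodrXr ell_sum_pred_nsub addnK. Qed.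

(** The exponents [n - ell sigma] and [ell sigma - ell pi] telescope, as [ell pi <= ell sigma <= n];
    the resulting sign is independent of [sigma]. *)
Lemma sign_mobius : (-1) ^+ (n - ell sigma) * mobius sigma pi =
  (-1) ^+ (n - ell pi) * \prod_(B in blocks pi) ((nsub sigma B).-1)`!%:R.
Proof.
rewrite mobiusE mulrA -exprD addnBA ?subnK ?ell_le //.
by rewrite ell_sum_pred_nsub leq_addl.
Qed.

End Refinement.

Lemma omega_x n (pi : setpart n) : omega (x pi) = (-1) ^+ (n - ell pi) *:
  \sum_(sigma | refines sigma pi)
     (\prod_(B in blocks pi) ((nsub sigma B).-1)`!%:R) *: p sigma.
Proof.
rewrite /x linear_sum scaler_sumr; apply: eq_bigr => sigma sp.
by rewrite linearZ /= omega_p !scalerA mulrC sign_mobius.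
Qed.

(** Positivity quantifies over all degrees, so [m] may differ from [n]; the coefficient then
    vanishes. *)
Lemma pcoef_omega_x m n (tau : setpart m) (pi : setpart n) :
  exists2 c : rat, 0 <= c & pcoef tau (omega (x pi)) = (-1) ^+ (n - ell pi) * c.
Proof.
rewrite omega_x linearZ /= linear_sum /=; eexists; last by [].
apply: sumr_ge0 => sigma _; rewrite linearZ /=; apply: mulr_ge0.
  by apply: prodr_ge0 => B _; exact: ler0n.
have [mn|mn] := eqVneq m n; last by rewrite pcoef_p_neq.
by move: tau; rewrite mn => tau; rewrite pcoef_p ler0n.
Qed.

Section OneBlock.
Variables (n : nat) (hn : (0 < n)%N).

Lemma refines_one_block (sigma : setpart n) : refines sigma (one_block hn).
Proof.
apply/forall_inP => A _; apply/exists_inP.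
by exists [set: 'I_n]; rewrite ?inE ?subsetT.
Qed.

Lemma ell_one_block : ell (one_block hn) = 1%N.
Proof. by rewrite /ell cards1. Qed.

(** The single block contains all [ell sigma] blocks of [sigma], so one factor remains. *)
Lemma prod_one_block (sigma : setpart n) :
  \prod_(B in blocks (one_block hn)) ((nsub sigma B).-1)`!%:R =
  ((ell sigma - 1)`!)%:R :> rat.
Proof.
by rewrite (ell_sum_nsub _ _ _ (refines_one_block sigma)) !big_set1 subn1.
Qed.

End OneBlock.

Theorem proposition4p3 (n : nat) (hn : (0 < n)%N) :
  [/\ x (one_block hn) =
        \sum_(sigma : setpart n)
           ((-1) ^+ (ell sigma - 1) * ((ell sigma - 1)`!)%:R) *: p sigma,
      omega (x (one_block hn)) =
        (-1) ^+ (n - 1) *: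
          \sum_(sigma : setpart n) ((ell sigma - 1)`!)%:R *: p sigma
    & forall pi : setpart n,
        p_positive (omega (x pi)) \/ p_negative (omega (x pi))].
Proof.
split=> [||pi].
- apply: eq_big => sigma; rewrite refines_one_block // => _.
  by rewrite mobiusE ?refines_one_block // ell_one_block prod_one_block.
- rewrite omega_x ell_one_block; congr (_ *: _).
  apply: eq_big => sigma; rewrite refines_one_block // => _.
  by rewrite prod_one_block.
(* The parity of [n - ell pi] fixes the common sign of all coefficients. *)
- have [odd_d|even_d] := boolP (odd (n - ell pi)); [right|left] => m tau.
    have [c c0 ->] := pcoef_omega_x _ _ tau pi.
    rewrite -signr_odd odd_d expr1 mulN1r oppr_eq0 oppr_lt0 => cn0.
    by rewrite lt0r cn0.
  have [c c0 ->] := pcoef_omega_x _ _ tau pi.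
  by rewrite -signr_odd (negbTE even_d) expr0 mul1r lt0r => ->.
Qed.
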